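(* Let $\mathbb{K}$ be a field of characteristic zero and $X$ an alphabet. Let $P=\sum_{\underline{x}\in X^*} M^{\underline{x}}\,\underline{x}\in\mathbb{K}\langle\langle X\rangle\rangle$. Then $P$ is group-like, i.e. $\Delta(P)=P\otimes P$, if and only if $M^\bullet$ is a symetral mould.
   Context: $X^*$ is the set of words on $X$, including the empty word $\emptyset=1$; $\mathbb{K}\langle\langle X\rangle\rangle$ is the algebra of non-commutative formal power series on $X$. The coproduct $\Delta$ is the (completed) algebra morphism $\mathbb{K}\langle\langle X\rangle\rangle\to \mathbb{K}\langle\langle X\rangle\rangle\hat\otimes\mathbb{K}\langle\langle X\rangle\rangle$ determined by $\Delta(x)=x\otimes 1+1\otimes x$ for every letter $x\in X$ and $\Delta(\underline{x}^1\underline{x}^2)=\Delta(\underline{x}^1)\Delta(\underline{x}^2)$, extended by linearity. A mould on $X$ is a map $M^\bullet:X^*\to\mathbb{K}$. For words $\underline{x}^1,\underline{x}^2$ of lengths $n,m$, $\mathrm{sh}(\underline{x}^1,\underline{x}^2)$ denotes the words obtained by interleaving the two words preserving the internal order of each; sums over it run over all $\binom{n+m}{n}$ interleavings, with multiplicity. The mould $M^\bullet$ is symetral if $\sum_{\underline{x}\in\mathrm{sh}(\underline{x}^1,\underline{x}^2)}M^{\underline{x}}=M^{\underline{x}^1}M^{\underline{x}^2}$ for all $\underline{x}^1,\underline{x}^2\in X^*$. *)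

(* Defs.v *)
From HB Require Import structures.
From mathcomp Require Import all_boot all_algebra.
From mathcomp Require Import boolp classical_sets functions cardinality fsbigop.

Set Implicit Arguments.
Unset Strict Implicit.
Unset Printing Implicit Defensive.

Import GRing.Theory.
Local Open Scope ring_scope.

(* Words are elements of [seq X]; the empty word is [[::]] and the product of
   words is concatenation. *)

Definition mould (K : Type) (X : Type) := seq X -> K.

(* An element of K<<X>> is the family of its coefficients, indexed by words. *)
Definition ncseries (K : Type) (X : Type) := seq X -> K.

(* The series \sum_w M^w w. *)
Definition mould_series (K : Type) (X : Type) (M : mould K X) : ncseries K X :=
  fun w => M w.

Definition monomial (K : nzRingType) (X : choiceType) (w : seq X) :
  ncseries K X := fun u => (u == w)%:R.

(* An element of the completed tensor square of K<<X>> is the family of its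
   coefficients on the elementary tensors u \otimes v of words. *)
Definition tseries (K : Type) (X : Type) := seq X * seq X -> K.

HB.instance Definition _ (K : nzRingType) (X : choiceType) :=
  GRing.Zmodule.copy (tseries K X) (seq X * seq X -> K).

Definition tens (K : nzRingType) (X : choiceType) (P Q : ncseries K X) :
  tseries K X := fun uv => P uv.1 * Q uv.2.

(* The product extending (u1 \otimes v1)(u2 \otimes v2) = u1 u2 \otimes v1 v2:
   the coefficient on u \otimes v sums over all the factorizations
   u = u1 u2 and v = v1 v2. *)
Definition tmul (K : nzRingType) (X : choiceType) (F G : tseries K X) :
  tseries K X := fun uv =>
  \sum_(i < (size uv.1).+1) \sum_(j < (size uv.2).+1)
    F (take i uv.1, take j uv.2) * G (drop i uv.1, drop j uv.2).

Section TensorRing.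
Variables (K : nzRingType) (X : choiceType).
Implicit Types F G H : tseries K X.

Let spl (V : nmodType) (u : seq X) (f : seq X -> seq X -> V) : V :=
  \sum_(i < (size u).+1) f (take i u) (drop i u).

Let spl_nil (V : nmodType) (f : seq X -> seq X -> V) : spl [::] f = f [::] [::].
Proof. by rewrite /spl big_ord1. Qed.

Let spl_cons (V : nmodType) x u (f : seq X -> seq X -> V) :
  spl (x :: u) f = f [::] (x :: u) + spl u (fun a => f (x :: a)).
Proof. by rewrite /spl big_ord_recl. Qed.

Let eq_spl (V : nmodType) u (f g : seq X -> seq X -> V) :
  (forall a b, f a b = g a b) -> spl u f = spl u g.
Proof. by move=> fg; apply: eq_bigr. Qed.

Let splD (V : nmodType) u (f g : seq X -> seq X -> V) :
  spl u (fun a b => f a b + g a b) = spl u f + spl u g.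
Proof. exact: big_split. Qed.

Let splA (V : nmodType) u (f : seq X -> seq X -> seq X -> V) :
  spl u (fun a b => spl a (fun c d => f c d b)) =
  spl u (fun a b => spl b (f a)).
Proof.
elim: u f => [|x u IH] f; first by rewrite !spl_nil.
rewrite !spl_cons spl_nil -[X in _ = _ + X](IH (fun a => f (x :: a))) -addrA.
by congr (_ + _); rewrite -splD; apply: eq_spl => a b; rewrite spl_cons.
Qed.

Let splC (V : nmodType) u v (f : seq X -> seq X -> seq X -> seq X -> V) :
  spl u (fun a b => spl v (f a b)) = spl v (fun c d => spl u (fun a b => f a b c d)).
Proof. exact: exchange_big. Qed.

Let spl_suml (u : seq X) (f : seq X -> seq X -> K) k :
  spl u f * k = spl u (fun a b => f a b * k).
Proof. exact: mulr_suml. Qed.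

Let spl_sumr (u : seq X) (f : seq X -> seq X -> K) k :
  k * spl u f = spl u (fun a b => k * f a b).
Proof. exact: mulr_sumr. Qed.

Let tmulE F G u v : tmul F G (u, v) =
  spl u (fun a b => spl v (fun c d => F (a, c) * G (b, d))).
Proof. by []. Qed.

Let tone : tseries K X := tens (monomial K [::]) (monomial K [::]).

Let spl_nill (V : nmodType) u (f : seq X -> seq X -> V) :
  (forall a b, a != [::] -> f a b = 0) -> spl u f = f [::] u.
Proof.
case: u => [|x u] f0; first by rewrite spl_nil.
by rewrite spl_cons [X in _ + X]big1 ?addr0 // => i _; rewrite f0.
Qed.

Let spl_nilr (V : nmodType) u (f : seq X -> seq X -> V) :
  (forall a b, b != [::] -> f a b = 0) -> spl u f = f u [::].
Proof.
elim: u f => [|x u IH] f f0; first by rewrite spl_nil.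
by rewrite spl_cons f0 // add0r IH // => a b /f0.
Qed.

Let tmulA : associative (@tmul K X).
Proof.
move=> F G H; apply/funext => -[u v]; rewrite !tmulE.
transitivity (spl u (fun a b => spl b (fun b1 b2 =>
    spl v (fun c d => spl d (fun d1 d2 =>
      F (a, c) * G (b1, d1) * H (b2, d2)))))).
  apply: eq_spl => a b; rewrite -splC; apply: eq_spl => c d.
  rewrite tmulE spl_sumr; apply: eq_spl => b1 b2.
  by rewrite spl_sumr; apply: eq_spl => d1 d2; rewrite mulrA.
rewrite -(splA _ (fun a b1 b2 => spl v (fun c d => spl d (fun d1 d2 =>
  F (a, c) * G (b1, d1) * H (b2, d2))))).
apply: eq_spl => a b.
transitivity (spl a (fun a1 a2 => spl v (fun c d => spl c (fun c1 c2 =>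
  F (a1, c1) * G (a2, c2) * H (b, d))))).
  apply: eq_spl => a1 a2; apply/esym.
  exact: (splA _ (fun c d1 d2 => F (a1, c) * G (a2, d1) * H (b, d2))).
rewrite splC; apply: eq_spl => c d.
rewrite tmulE spl_suml; apply: eq_spl => a1 a2.
by rewrite spl_suml.
Qed.

Let tmul1l : left_id tone (@tmul K X).
Proof.
move=> F; apply/funext => -[u v]; rewrite tmulE spl_nill.
  rewrite spl_nill; first by rewrite /tone /tens /monomial !eqxx !mul1r.
  by move=> c d /negPf c0; rewrite /tone /tens /monomial /= c0 mulr0 mul0r.
move=> a b /negPf a0; apply: big1 => i _.
by rewrite /tone /tens /monomial /= a0 !mul0r.
Qed.

Let tmul1r : right_id tone (@tmul K X).
Proof.
move=> F; apply/funext => -[u v]; rewrite tmulE spl_nilr.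
  rewrite spl_nilr; first by rewrite /tone /tens /monomial !eqxx !mulr1.
  by move=> c d /negPf c0; rewrite /tone /tens /monomial /= c0 !mulr0.
move=> a b /negPf a0; apply: big1 => i _.
by rewrite /tone /tens /monomial /= a0 mul0r mulr0.
Qed.

Let tmulDl : left_distributive (@tmul K X) +%R.
Proof.
move=> F G H; apply/funext => -[u v]; rewrite [RHS]/GRing.add /= !tmulE -splD.
by apply: eq_spl => a b; rewrite -splD; apply: eq_spl => c d; rewrite -mulrDl.
Qed.

Let tmulDr : right_distributive (@tmul K X) +%R.
Proof.
move=> F G H; apply/funext => -[u v]; rewrite [RHS]/GRing.add /= !tmulE -splD.
by apply: eq_spl => a b; rewrite -splD; apply: eq_spl => c d; rewrite -mulrDr.
Qed.

Let tone_neq0 : tone != 0.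
Proof.
apply/eqP => /(congr1 (fun F : tseries K X => F ([::], [::]))) /eqP.
by rewrite /tone /tens /monomial !eqxx mulr1 oner_eq0.
Qed.

HB.instance Definition _ := GRing.Zmodule_isNzRing.Build (tseries K X)
  tmulA tmul1l tmul1r tmulDl tmulDr tone_neq0.

Lemma tseries_oneE :
  1 = tens (monomial K [::]) (monomial K [::]) :> tseries K X.
Proof. by []. Qed.

Lemma tseries_mulE F G : F * G = tmul F G.
Proof. by []. Qed.

Lemma tseries_addE F G uv : (F + G) uv = F uv + G uv.
Proof. by []. Qed.

End TensorRing.

Definition Delta_letter (K : nzRingType) (X : choiceType) (x : X) :
  tseries K X :=
  tens (monomial K [:: x]) (monomial K [::]) +
  tens (monomial K [::]) (monomial K [:: x]).

Definition Delta_word (K : nzRingType) (X : choiceType) (w : seq X) :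
  tseries K X := \prod_(x <- w) Delta_letter K x.

(* Delta (\sum_w P^w w) = \sum_w P^w Delta(w), coefficientwise.  [\sum_(_ \in _)]
   is the sum of a finitely supported family (and 0 for any other one); the
   support is always finite here, see [Delta_support] below, although X may be
   infinite. *)
Definition Delta (K : nzRingType) (X : choiceType) (P : ncseries K X) :
  tseries K X := fun uv => \sum_(w \in [set: seq X]) P w * Delta_word K w uv.

Definition group_like (K : nzRingType) (X : choiceType) (P : ncseries K X) :=
  Delta P = tens P P.

(* The interleavings of two words, as a list, so with multiplicity. *)
Fixpoint sh (X : Type) (u : seq X) : seq X -> seq (seq X) :=
  if u is x :: u' then
    fix sh_u (v : seq X) : seq (seq X) :=
      if v is y :: v' then
        [seq x :: w | w <- sh u' v] ++ [seq y :: w | w <- sh_u v']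
      else [:: u]
  else fun v => [:: v].

Definition symetral (K : nzRingType) (X : Type) (M : mould K X) :=
  forall u v : seq X, \sum_(w <- sh u v) M w = M u * M v.

Section Facts.
Variables (K : nzRingType) (X : choiceType).
Implicit Types (u v w : seq X) (x : X).

Lemma Delta_word_nil : Delta_word K ([::] : seq X) = 1.
Proof. exact: big_nil. Qed.

Lemma Delta_word_cat u v :
  Delta_word K (u ++ v) = Delta_word K u * Delta_word K v.
Proof. exact: big_cat. Qed.

Lemma Delta_word_perm w u v :
  Delta_word K w (u, v) != 0 -> perm_eq w (u ++ v).
Proof.
elim: w u v => [|x w IH] u v.
  rewrite Delta_word_nil tseries_oneE /tens /monomial /=.
  by case: u v => [|? ?] [|? ?]; rewrite ?(mulr0, mul0r) ?eqxx.
rewrite -cat1s Delta_word_cat tseries_mulE; apply: contra_neqT => nperm.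
apply: big1 => i _; apply: big1 => j _ /=.
have [->|/IH wP] := eqVneq (Delta_word K w (drop i u, drop j v)) 0.
  by rewrite mulr0.
suff -> : Delta_word K [:: x] (take i u, take j v) = 0 by rewrite mul0r.
rewrite /Delta_word big_seq1 /Delta_letter tseries_addE /tens /monomial /=.
have [ux|_] := eqVneq (take i u) [:: x]; have [uN|_] := eqVneq (take i u) [::];
  have [vx|_] := eqVneq (take j v) [:: x]; have [vN|_] := eqVneq (take j v) [::];
  rewrite ?(mulr0, mul0r, addr0) //; exfalso; move/negP: nperm; apply;
  rewrite -(cat_take_drop i u) -(cat_take_drop j v) ?ux ?uN ?vx ?vN /=;
  try congruence.
- by rewrite perm_cons.
- by rewrite perm_sym -cat1s perm_catCA /= perm_cons perm_sym.
Qed.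

Lemma Delta_support (P : ncseries K X) uv :
  finite_set [set w | P w * Delta_word K w uv != 0].
Proof.
case: uv => u v; apply: (@sub_finite_set _ _ [set` permutations (u ++ v)]).
  move=> w /= Pw; rewrite mem_permutations; apply: Delta_word_perm.
  by apply: contra_neq Pw => ->; rewrite mulr0.
exact: finite_seq.
Qed.

Lemma Delta_monomial w : Delta (monomial K w) = Delta_word K w.
Proof.
apply/funext => uv; rewrite /Delta.
rewrite -(fsbig_widen [set w]) ?fsbig_set1 => [||u [_ /eqP /negPf /= uw]] //.
  by rewrite /monomial eqxx mul1r.
by rewrite /monomial uw mul0r.
Qed.

Lemma size_sh u v : size (sh u v) = 'C(size u + size v, size u).
Proof.
elim: u v => [|x u IHu] v; first by rewrite bin0.
elim: v => [|y v IHv]; first by rewrite addn0 binn.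
rewrite [LHS]/= size_cat !size_map IHu.
rewrite -[X in (_ + size X)%N]/(sh (x :: u) v) IHv /=.
by rewrite [in RHS]addSn binS [RHS]addnC addnS addSn.
Qed.

(* An interleaving is given by the positions of the letters of [u] in it. *)
Lemma mem_sh u v w : (w \in sh u v) <->
  exists2 m : bitseq, size m = size w & mask m w = u /\ mask (map negb m) w = v.
Proof.
elim: u v w => [|x u IHu] v w.
  rewrite inE; split=> [/eqP ->|[m sm [m0 mv]]].
    exists (nseq (size v) false); rewrite ?size_nseq //.
    by rewrite mask_false map_nseq mask_true.
  apply/eqP; rewrite -mv; elim: m w sm m0 {mv} => [|[] m IH] [|z w] //= [sm].
  by move=> m0; congr (_ :: _); apply: IH.
elim: v w => [|y v IHv] w.
  rewrite inE; split=> [/eqP ->|[m sm [mu m0]]].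
    exists (nseq (size (x :: u)) true); rewrite ?size_nseq //.
    by rewrite mask_true // map_nseq mask_false.
  apply/eqP; rewrite -mu; elim: m w sm m0 {mu} => [|[] m IH] [|z w] //= [sm].
  by move=> m0; congr (_ :: _); apply: IH.
rewrite [sh _ _]/= mem_cat; split.
  case/orP => /mapP [w' w'P ->].
    have /IHu [m sm [mu mv]] := w'P.
    by exists (true :: m); rewrite /= ?sm ?mu ?mv.
  have /IHv [m sm [mu mv]] := w'P.
  by exists (false :: m); rewrite /= ?sm ?mu ?mv.
case=> -[|[] m]; case: w => [|z w] //=; first by move=> _ [].
all: case=> sm [].
- move=> [<- mu] mv; apply/orP; left; apply: map_f.
  by apply/IHu; exists m.
- move=> mu [<- mv]; apply/orP; right; apply: map_f.
  by apply/IHv; exists m.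
Qed.

End Facts.

(* Main.v *)
Require Import Defs.
From mathcomp Require Import all_boot all_algebra.
From mathcomp Require Import boolp classical_sets fsbigop.

Import GRing.Theory.
Local Open Scope ring_scope.

(** A series is group-like exactly when its coefficients are symetral because
    [Delta] is the transpose of the shuffle product: the coefficient of
    [Delta w] on the elementary tensor of [u] and [v] is the multiplicity of
    [w] among the interleavings of [u] and [v] ([Delta_word_count]). Both sides
    of this identity obey the same recursion on [w]: the first letter of [w]
    has to be removed from the front of [u] or from the front of [v]. For the
    coproduct this is multiplication by [x (x) 1 + 1 (x) x]
    ([Delta_word_cons]); for the shuffle it is the definition of [sh].

    Summing over [w], the coefficient of [Delta P] on [u] and [v] is the sum
    of the coefficients of [P] over the interleavings of [u] and [v]
    ([Delta_sum_sh]). That of [tens P P] is [P u * P v], so comparing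
    coefficients gives the symetrality relations one by one. *)

(** At most one factorization of [u] has left factor [a]. Multiplying a series
    on the left by the word [a] therefore shifts its coefficients. *)
Lemma sum_monomial_take (K : nzRingType) (X : choiceType) (a u : seq X)
    (f : seq X -> K) :
  \sum_(i < (size u).+1) monomial K a (take i u) * f (drop i u) =
  if prefix a u then f (drop (size a) u) else 0.
Proof.
have [/prefixP[b ->]|not_prefix] := boolP (prefix a u); last first.
  apply: big1 => i _; rewrite /monomial; case: eqP => [ua|_]; last first.
    by rewrite mul0r.
  by rewrite -ua prefix_take in not_prefix.
have lt_a : (size a < (size (a ++ b)).+1)%N by rewrite ltnS size_cat leq_addr.
rewrite (bigD1 (Ordinal lt_a)) //= big1 ?addr0 => [|i ne_i].
  by rewrite /monomial take_size_cat ?eqxx ?mul1r.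
rewrite /monomial; case: eqP => [take_i|_]; last by rewrite mul0r.
case/eqP: ne_i; apply: val_inj => /=.
by have := congr1 size take_i; rewrite size_takel // -ltnS.
Qed.

Lemma tens_monomial_mul (K : nzRingType) (X : choiceType) (a b u v : seq X)
    (F : tseries K X) :
  (tens (monomial K a) (monomial K b) * F) (u, v) =
  if prefix a u && prefix b v then F (drop (size a) u, drop (size b) v) else 0.
Proof.
rewrite tseries_mulE /tmul /tens /=.
under eq_bigr => i _.
  under eq_bigr => j _ do rewrite -mulrA.
  rewrite -mulr_sumr (sum_monomial_take K X b v (fun c => F (drop i u, c))).
  over.
rewrite (sum_monomial_take K X a u
  (fun c => if prefix b v then F (c, drop (size b) v) else 0)).
by case: prefix.
Qed.

(** The two summands come from the two terms of [Delta_letter K x]: the letter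
    [x] is taken from the front of [u] or from the front of [v]. *)
Lemma Delta_word_cons (K : nzRingType) (X : choiceType) x (w u v : seq X) :
  Delta_word K (x :: w) (u, v) =
  (if prefix [:: x] u then Delta_word K w (behead u, v) else 0) +
  (if prefix [:: x] v then Delta_word K w (u, behead v) else 0).
Proof.
rewrite {1}/Delta_word big_cons -/(Delta_word K w) /Delta_letter mulrDl.
by rewrite tseries_addE !tens_monomial_mul !prefix0s !drop0 !drop1 andbT.
Qed.

Lemma count_map_cons (X : choiceType) (x : X) (w : seq X) y s :
  count_mem (x :: w) [seq y :: t | t <- s] =
  (if x == y then count_mem w s else 0)%N.
Proof.
rewrite count_map; have [->|ne_xy] := eqVneq x y.
  by apply: eq_count => t /=; rewrite eqseq_cons eqxx.
rewrite -(count_pred0 s); apply: eq_count => t /=.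
by rewrite eqseq_cons eq_sym (negPf ne_xy).
Qed.

(** The recursion [Delta_word_cons] is the one that counts interleavings by
    their first letter. *)
Lemma Delta_word_count (K : nzRingType) (X : choiceType) (w u v : seq X) :
  Delta_word K w (u, v) = (count_mem w (sh u v))%:R.
Proof.
elim: w u v => [|x w IHw] u v.
  rewrite Delta_word_nil tseries_oneE /tens /monomial /=.
  case: u v => [|y u] [|z v]; rewrite ?mul1r ?mul0r //=.
  by rewrite count_cat !count_map !(@eq_count _ _ pred0) ?count_pred0.
rewrite Delta_word_cons !IHw.
case: u v => [|y u] [|z v]; rewrite /= ?prefix0s ?addr0 ?add0r ?addn0 //.
- by rewrite eqseq_cons eq_sym andbT; case: eqP.
- have -> : sh u [::] = [:: u] by case: (u).
  by rewrite /= addn0 eqseq_cons eq_sym andbT; case: eqP.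
by rewrite !andbT count_cat !count_map_cons natrD; do 2!case: (x == _).
Qed.

(** The multiplicities of [Delta_word_count] turn the sum over all words into
    a sum over the list [sh u v], where a word counts as often as it occurs. *)
Lemma Delta_sum_sh (K : nzRingType) (X : choiceType) (P : ncseries K X)
    (u v : seq X) :
  Delta P (u, v) = \sum_(w <- sh u v) P w.
Proof.
(* The right side becomes a sum over distinct words, each term being repeated
   by [iterop] as many times as the word occurs, that is [P w *+ n]. *)
rewrite /Delta -(@big_undup_iterop_count _ _ _ _ (sh u v) xpredT P) /=.
rewrite -(@fsbig_widen _ _ _ _ [set` undup (sh u v)]) //.
  rewrite -fsbig_seq ?undup_uniq //; apply: eq_bigr => w _.
  by rewrite Delta_word_count mulr_natr.
move=> w [_ /=]; rewrite mem_undup => /negP w_sh.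
by rewrite Delta_word_count (count_memPn w_sh) mulr0.
Qed.

Theorem mainTheorem3 (K : fieldType) (charK : [pchar K] =i pred0)
  (X : choiceType) (M : mould K X) :
  group_like (mould_series M) <-> symetral M.
Proof.
split=> [Mgl u v | Msym].
  by rewrite -[LHS](Delta_sum_sh K X (mould_series M)) Mgl.
by apply/funext => -[u v]; rewrite Delta_sum_sh Msym.
Qed.
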